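(* Danceability is a knot invariant. That is, if $K_1$ and $K_2$ are equivalent (ambient isotopic) knots in $\mathbb{R}^3$, then $da(K_1)=da(K_2)$; equivalently, if $da(K_1)\neq da(K_2)$ then $K_1$ and $K_2$ are distinct knots.
   Context: A knot is a (tame) closed curve in $\mathbb{R}^3$ with no self-intersections; two knots are regarded as the same if one can be deformed into the other by ambient isotopy. A knot diagram of a knot $K$ is a planar projection of a curve equivalent to $K$, with finitely many transverse double points (crossings), no triple points, and with the over- and under-strand recorded at each crossing. An oriented knot diagram is a knot diagram with a chosen direction of travel along the knot. $n$-danceability ($n\ge 2$): an oriented knot diagram is $n$-danceable if there exist $n$ distinct initial points on the diagram such that: (1) one dancer starts at each of the $n$ initial points; (2) each dancer travels in the direction of the orientation and stops on reaching the next initial point, so that the paths of all dancers together traverse the entire diagram with no overlap; (3) the speeds of the dancers can vary and can be chosen so that the simultaneous tracing of the diagram by all $n$ dancers follows the under-first rule at every crossing, i.e. the under-strand of each crossing is passed strictly before the over-strand of that crossing is passed. Precisely: let the diagram be the image of an oriented circle $S^1$ under the projection, and let $p_0,\dots,p_{n-1}\in S^1$ be the initial points in cyclic order along the orientation, chosen so that they do not project to crossings. Dancer $i$ starts at $p_i$ at time $0$ and moves continuously and monotonically (pausing is allowed) along the oriented arc from $p_i$ to $p_{i+1}$ (indices mod $n$), starting simultaneously with the other dancers and using a common clock. For each crossing, the point of $S^1$ on the under-strand must be traversed at a strictly earlier time than the point of $S^1$ on the over-strand. $1$-danceability: a knot diagram is $1$-danceable if an orientation and a single initial point can be chosen so that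 one dancer, starting at this point and traversing the entire knot once in the direction of the orientation back to the starting point, passes through every crossing on the under-strand first. Danceability: for a knot $K$, $da(K)$ is the minimal $n\ge 1$ for which there is an (oriented) diagram of $K$ that is $n$-danceable, the minimum being taken over all diagrams of $K$ and both orientations. *)

(* Defs.v *)
From HB Require Import structures.
From mathcomp Require Import all_boot all_order all_algebra.
From mathcomp Require Import all_classical all_reals all_analysis.

Set Implicit Arguments.
Unset Strict Implicit.
Unset Printing Implicit Defensive.

Import Order.TTheory GRing.Theory Num.Theory.
Import numFieldNormedType.Exports.
Local Open Scope classical_set_scope.
Local Open Scope ring_scope.

(* The circle S^1 is R/Z: closed curves are 1-periodic functions of a real
   parameter, and the orientation is the direction of increasing parameter. *)

Record simple_closed_curve (R : realType) (c : R -> 'rV[R]_3) : Prop := {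
  scc_continuous : continuous c;
  scc_periodic : periodic c 1;
  scc_injective : forall s t : R, 0 <= s < 1 -> 0 <= t < 1 ->
    c s = c t -> s = t }.

Definition polygonal (R : realType) (c : R -> 'rV[R]_3) : Prop :=
  exists (m : nat) (tau : nat -> R),
    [/\ tau 0%N = 0, tau m = 1 &
        forall i, (i < m)%N -> tau i < tau i.+1 /\
          exists a v : 'rV[R]_3,
            forall t, tau i <= t <= tau i.+1 -> c t = a + t *: v].

Definition homeomorphism (T : topologicalType) (f : T -> T) : Prop :=
  exists g : T -> T,
    [/\ cancel f g, cancel g f, continuous f & continuous g].

Record ambient_isotopy (R : realType) (H : R -> 'rV[R]_3 -> 'rV[R]_3) : Prop := {
  ai_continuous : {within `[0, 1]%classic `*` [set: 'rV[R]_3],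
    continuous (fun z : R * 'rV[R]_3 => H z.1 z.2)};
  ai_homeomorphism : forall t : R, 0 <= t <= 1 -> homeomorphism (H t);
  ai_start : forall x, H 0 x = x }.

Definition ambient_isotopic (R : realType) (A B : set 'rV[R]_3) : Prop :=
  exists2 H, ambient_isotopy H & H 1 @` A = B.

(* Tameness: ambient isotopic to a simple closed polygon. *)
Record knot (R : realType) := Knot {
  knot_set :> set 'rV[R]_3;
  knot_curve : exists2 c : R -> 'rV[R]_3,
    simple_closed_curve c & range c = knot_set;
  knot_tame : exists c : R -> 'rV[R]_3,
    [/\ simple_closed_curve c, polygonal c & ambient_isotopic (range c) knot_set] }.

(* Diagrams are projections along the third coordinate axis: [shadow] forgets
   the third coordinate and [height] tells the over-strand from the
   under-strand. *)
Definition shadow (R : realType) (c : R -> 'rV[R]_3) (t : R) : 'rV[R]_2 :=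
  col' ord_max (c t).

Definition height (R : realType) (c : R -> 'rV[R]_3) (t : R) : R :=
  c t 0 ord_max.

(* The parameters [u] and [o] are the under- and the over-passage of a
   crossing; being a condition on the values of [c], this is invariant under
   integer shifts of either parameter. *)
Definition crossing (R : realType) (c : R -> 'rV[R]_3) (u o : R) : Prop :=
  shadow c u = shadow c o /\ height c u < height c o.

Definition not_at_crossing (R : realType) (c : R -> 'rV[R]_3) (p : R) : Prop :=
  forall q, ~ crossing c p q /\ ~ crossing c q p.

Definition transverse (R : realType) (c : R -> 'rV[R]_3) (u o : R) : Prop :=
  [/\ derivable (shadow c) u 1, derivable (shadow c) o 1 &
      row_free (col_mx ('D_1 (shadow c) u) ('D_1 (shadow c) o))].

Record regular_projection (R : realType) (c : R -> 'rV[R]_3) : Prop := {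
  rp_finite : finite_set [set z : R * R |
    [/\ 0 <= z.1 < 1, 0 <= z.2 < 1 & crossing c z.1 z.2]];
  rp_no_triple : forall r s t : R,
    0 <= r < 1 -> 0 <= s < 1 -> 0 <= t < 1 ->
    shadow c r = shadow c s -> shadow c s = shadow c t ->
    [\/ r = s, s = t | r = t];
  rp_transverse : forall u o : R, crossing c u o -> transverse c u o }.

(* An oriented diagram of [K] is given by a parametrized curve lying over it. *)
Record oriented_diagram_of (R : realType) (K : set 'rV[R]_3)
    (c : R -> 'rV[R]_3) : Prop := {
  od_curve : simple_closed_curve c;
  od_regular : regular_projection c;
  od_equivalent : ambient_isotopic K (range c) }.

Definition reverse (R : realType) (c : R -> 'rV[R]_3) : R -> 'rV[R]_3 :=
  fun t => c (- t).

(* Real lifts of [n] points of R/Z in cyclic order; [p n] is again the first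
   point, one turn later. *)
Record initial_points (R : realType) (c : R -> 'rV[R]_3) (n : nat)
    (p : nat -> R) : Prop := {
  ip_cyclic : forall i, (i < n)%N -> p i < p i.+1;
  ip_turn : p n = p 0%N + 1;
  ip_generic : forall i, (i < n)%N -> not_at_crossing c (p i) }.

(* [x t] is the position at time [t] of a dancer going from [a] to [b]. *)
Record dancer (R : realType) (T a b : R) (x : R -> R) : Prop := {
  dancer_continuous : {within `[0, T]%classic, continuous x};
  dancer_monotone : {in `[0, T] &, {homo x : s t / s <= t}};
  dancer_start : x 0 = a;
  dancer_stop : x T = b }.

(* A dancer may pause on a crossing, so a passage need not be instantaneous:
   every instant spent on the under-strand of a crossing must precede every
   instant spent on its over-strand. *)
Definition under_first (R : realType) (c : R -> 'rV[R]_3) (n : nat) (T : R)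
    (x : nat -> R -> R) : Prop :=
  forall i j, (i < n)%N -> (j < n)%N ->
  forall s t : R, 0 <= s <= T -> 0 <= t <= T ->
  crossing c (x i s) (x j t) -> s < t.

Definition n_danceable (R : realType) (n : nat) (c : R -> 'rV[R]_3) : Prop :=
  exists (p : nat -> R) (T : R) (x : nat -> R -> R),
    [/\ initial_points c n p, 0 < T,
        forall i, (i < n)%N -> dancer T (p i) (p i.+1) (x i) &
        under_first c n T x].

Definition one_danceable_oriented (R : realType) (c : R -> 'rV[R]_3) : Prop :=
  exists2 p : R, not_at_crossing c p &
    forall u o : R, p <= u < p + 1 -> p <= o < p + 1 ->
      crossing c u o -> u < o.

Definition one_danceable (R : realType) (c : R -> 'rV[R]_3) : Prop :=
  one_danceable_oriented c \/ one_danceable_oriented (reverse c).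

Definition danceable (R : realType) (n : nat) (c : R -> 'rV[R]_3) : Prop :=
  match n with
  | 0 => False
  | 1 => one_danceable c
  | _ => n_danceable n c
  end.

Definition has_danceable_diagram (R : realType) (K : set 'rV[R]_3) : pred nat :=
  fun n => `[< exists2 c, oriented_diagram_of K c & danceable n c >].

(* The minimum; [None] would mean that no diagram of [K] is [n]-danceable for
   any [n]. *)
Definition da (R : realType) (K : knot R) : option nat :=
  match pselect (exists n, has_danceable_diagram K n) with
  | left ex => Some (ex_minn ex)
  | right _ => None
  end.

(* Main.v *)
Require Import Defs.
From mathcomp Require Import all_boot all_order all_algebra.
From mathcomp Require Import all_classical all_reals all_analysis.

(** The danceability of [K] depends on [K] only through the set of diagrams
    ambient isotopic to it, so the theorem says that ambient isotopic knots have
    the same diagrams. This follows once [ambient_isotopic] is known to be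
    symmetric and transitive: an isotopy from [K1] to [K2] lets every isotopy
    starting at one of them be replaced by one starting at the other, with the
    same end.

    Both properties come from explicit isotopies. If [H] carries [A] to [B],
    then [fun t => H (1 - t) \o (H 1)^-1] carries [B] back to [A]; taking the
    inverse of the final homeomorphism only, instead of the family of the
    inverses of the [H t], makes joint continuity immediate. If moreover [G]
    carries [B] to [C], then [fun t => G t \o H t] carries [A] to [C]; running
    both isotopies at once, instead of one after the other, avoids gluing. *)

Set Implicit Arguments.
Unset Strict Implicit.
Unset Printing Implicit Defensive.

Import Order.TTheory GRing.Theory Num.Theory.
Import numFieldNormedType.Exports.
Local Open Scope classical_set_scope.
Local Open Scope ring_scope.

(** An isotopy [H] is unconstrained at times outside [0, 1], where it may be
    discontinuous, so composites have to be formed relative to that interval. *)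
Lemma within_continuous_comp (T U V : topologicalType) (A : set T) (B : set U)
    (f : T -> U) (g : U -> V) :
  {homo f : x / A x >-> B x} ->
  {within A, continuous f} -> {within B, continuous g} ->
  {within A, continuous (g \o f)}.
Proof.
move=> fAB /subspace_continuousP cf /subspace_continuousP cg.
apply/subspace_continuousP => x Ax.
apply: cvg_comp (cg _ (fAB _ Ax)).
move=> P /(cf x Ax); rewrite /within /fmap /nbhs /=.
by apply: filterS => y + Ay; apply => //; exact: fAB.
Qed.

Lemma within_continuous_pair (T U V : topologicalType) (A : set T)
    (f : T -> U) (g : T -> V) :
  {within A, continuous f} -> {within A, continuous g} ->
  {within A, continuous (fun x => (f x, g x))}.
Proof. by move=> cf cg x; apply: cvg_pair; [exact: cf|exact: cg]. Qed.

Lemma homeomorphism_comp (T : topologicalType) (f g : T -> T) :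
  homeomorphism f -> homeomorphism g -> homeomorphism (g \o f).
Proof.
move=> [f' [fK f'K cf cf']] [g' [gK g'K cg cg']].
exists (f' \o g'); split; [exact: can_comp|exact: can_comp| |].
- by move=> x; apply: continuous_comp; [exact: cf|exact: cg].
- by move=> x; apply: continuous_comp; [exact: cg'|exact: cf'].
Qed.

Section AmbientIsotopy.
Variable R : realType.
Implicit Types (A B C : set 'rV[R]_3) (G H : R -> 'rV[R]_3 -> 'rV[R]_3).

(** Joint continuity holds because the composite factors through the map
    [(t, x) |-> (t, H t x)] of the cylinder over [0, 1] to itself. *)
Lemma ambient_isotopy_comp H G : ambient_isotopy H -> ambient_isotopy G ->
  ambient_isotopy (fun t => G t \o H t).
Proof.
move=> [cH hH H0] [cG hG G0]; split.
- refine (within_continuous_comp (f := fun z : R * 'rV[R]_3 => (z.1, H z.1 z.2))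
    _ _ cG); first by move=> z [].
  apply: within_continuous_pair cH.
  by apply: continuous_subspaceT => z; exact: cvg_fst.
- by move=> t t01; apply: homeomorphism_comp; [exact: hH|exact: hG].
- by move=> x /=; rewrite H0 G0.
Qed.

(** Time is reversed, and the factor [g], the inverse of [H 1], makes the
    reversed family start at the identity; it ends at [H 0 \o g = g]. *)
Lemma ambient_isotopy_reverse H g : ambient_isotopy H ->
  cancel (H 1) g -> cancel g (H 1) -> continuous g ->
  ambient_isotopy (fun t => H (1 - t) \o g).
Proof.
move=> [cH hH H0] H1K gK cg.
have cH1 : continuous (H 1).
  by have [|? []//] := hH 1; rewrite ler01 lexx.
have onem_itv t : 0 <= t <= 1 -> 0 <= 1 - t <= 1.
  by move=> /andP[t0 t1]; rewrite subr_ge0 t1 gerBl.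
split.
- refine (within_continuous_comp (f := fun z : R * 'rV[R]_3 => (1 - z.1, g z.2))
    _ _ cH).
    by move=> z [+ _]; rewrite /= !in_itv /= => /onem_itv.
  apply: continuous_subspaceT => z.
  have c1 : 1 - y.1 @[y --> z] --> 1 - z.1.
    by apply: cvgB; [exact: cvg_cst|exact: cvg_fst].
  have c2 : g y.2 @[y --> z] --> g z.2.
    exact: (cvg_comp snd g cvg_snd (cg z.2)).
  exact: cvg_pair c1 c2.
- move=> t /onem_itv t01; apply: homeomorphism_comp; last exact: hH.
  by exists (H 1).
- by move=> x /=; rewrite subr0 gK.
Qed.

Lemma ambient_isotopic_sym A B : ambient_isotopic A B -> ambient_isotopic B A.
Proof.
move=> [H aiH <-].
have [g [H1K gK _ cg]] : homeomorphism (H 1).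
  by apply: (ai_homeomorphism aiH); rewrite ler01 lexx.
exists (fun t => H (1 - t) \o g); first exact: ambient_isotopy_reverse.
(* [H (1 - 1) \o g] maps [H 1 @` A] to [g @` (H 1 @` A)], which is [A]. *)
rewrite -image_comp (_ : g @` _ = A) ?subrr.
  by rewrite (_ : H 0 = id) ?image_id//; apply/funext; exact: ai_start aiH.
by rewrite image_comp (_ : g \o H 1 = id) ?image_id//; apply/funext.
Qed.

Lemma ambient_isotopic_trans A B C :
  ambient_isotopic A B -> ambient_isotopic B C -> ambient_isotopic A C.
Proof.
move=> [H aiH <-] [G aiG <-].
exists (fun t => G t \o H t); first exact: ambient_isotopy_comp.
by rewrite image_comp.
Qed.

Lemma oriented_diagram_of_isotopic A B (c : R -> 'rV[R]_3) :
  ambient_isotopic A B -> oriented_diagram_of A c -> oriented_diagram_of B c.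
Proof.
move=> AB [curve_c regular_c Ac]; split => //.
exact: ambient_isotopic_trans (ambient_isotopic_sym AB) Ac.
Qed.

Lemma has_danceable_diagram_isotopic A B :
  ambient_isotopic A B -> has_danceable_diagram A = has_danceable_diagram B.
Proof.
move=> AB; apply/funext => n; apply: asbool_equiv_eq.
split=> -[c diag_c dance_c]; exists c => //.
  exact: oriented_diagram_of_isotopic AB diag_c.
exact: oriented_diagram_of_isotopic (ambient_isotopic_sym AB) diag_c.
Qed.

End AmbientIsotopy.

Theorem theorem1 (R : realType) (K1 K2 : knot R) :
  ambient_isotopic K1 K2 -> da K1 = da K2.
Proof.
by move=> K12; rewrite /da (has_danceable_diagram_isotopic K12).
Qed.
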